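(* Let $\mu,\nu\in\mathscr{P}(\mathbb{R}^{d})$ and $\gamma\in\mathscr{P}(\mathbb{R}^{d}\times\mathbb{R}^{d})$, and assume that the set $\{\pi\in\Pi(\mu,\nu):H(\pi|\gamma)<\infty\}$ is non-empty. For $\varepsilon>0$ let $\pi^{*,\varepsilon}$ be the optimizer of $$\inf_{\pi\in\mathscr{P}(\mathbb{R}^{d}\times\mathbb{R}^{d})}\bigl\{\varepsilon^{-1}\operatorname{OT}(\mu,\pi_{x})+\varepsilon^{-1}\operatorname{OT}(\nu,\pi_{y})+H(\pi|\gamma)\bigr\}.$$ Then $\pi^{*,\varepsilon}$ converges to $\pi^{*,0}$ in the weak topology as $\varepsilon\to0$, where $\pi^{*,0}$ is the unique solution to $\inf_{\pi\in\Pi(\mu,\nu)}H(\pi|\gamma)$.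
   Context: $\mathscr{P}(\mathcal{Z})$ denotes Borel probability measures on $\mathcal{Z}$; $\Pi(\mu,\nu)$ denotes couplings of $\mu$ and $\nu$; $\pi_{x},\pi_{y}$ are the first and second marginals of $\pi$. $H(\pi|\gamma)=E_{\pi}[\log(\mathrm{d}\pi/\mathrm{d}\gamma)]$ if $\pi\ll\gamma$ and $+\infty$ otherwise. The transport cost is the quadratic one: $\operatorname{OT}(\mu,\mu')=\inf_{\kappa\in\Pi(\mu,\mu')}E_{\kappa}[\tfrac12\|X-X'\|^{2}]$. *)

(* Defs.v *)
From HB Require Import structures.
From mathcomp Require Import all_boot all_order all_algebra.
From mathcomp Require Import all_classical all_reals all_analysis.
From mathcomp Require Import giry.

Set Implicit Arguments.
Unset Strict Implicit.
Unset Printing Implicit Defensive.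

Import Order.TTheory GRing.Theory Num.Theory.
Import numFieldNormedType.Exports.

Local Open Scope classical_set_scope.
Local Open Scope ring_scope.
Local Open Scope ereal_scope.
Local Open Scope charge_scope.

(* A topological space with its Borel sigma-algebra; on a product, this is the
   one generated by the open sets of the product topology. Its carrier unfolds
   to T itself. *)
Definition borel (T : ptopologicalType) :
    measurableType (sigma_display (@open T)) :=
  g_sigma_algebraType (@open T).

(* Only triggers the missing join of the topological and pointed structures. *)
HB.instance Definition _ (X Y : ptopologicalType) := Pointed.on (X * Y)%type.

Section projections.
Context {X Y : ptopologicalType}.

Definition bfst : borel (X * Y)%type -> borel X := fst.
Definition bsnd : borel (X * Y)%type -> borel Y := snd.

Lemma measurable_bfst : measurable_fun [set: borel (X * Y)%type] bfst.
Proof.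
apply: (@measurability _ _ (borel (X * Y)%type) (borel X) _ _ (@open X)) => //.
move=> _ [A oA <-]; rewrite setTI; apply: sub_sigma_algebra.
by apply: (@open_comp _ _ (@fst X Y) A _ oA) => z _; exact: cvg_fst.
Qed.

Lemma measurable_bsnd : measurable_fun [set: borel (X * Y)%type] bsnd.
Proof.
apply: (@measurability _ _ (borel (X * Y)%type) (borel Y) _ _ (@open Y)) => //.
move=> _ [A oA <-]; rewrite setTI; apply: sub_sigma_algebra.
by apply: (@open_comp _ _ (@snd X Y) A _ oA) => z _; exact: cvg_snd.
Qed.

HB.instance Definition _ := isMeasurableFun.Build _ _ _ _ bfst measurable_bfst.
HB.instance Definition _ := isMeasurableFun.Build _ _ _ _ bsnd measurable_bsnd.

End projections.

Section couplings.
Context {R : realType} {X Y : ptopologicalType}.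
Implicit Types pi : probability (borel (X * Y)%type) R.

Definition marginal1 pi : probability (borel X) R := distribution pi bfst.
Definition marginal2 pi : probability (borel Y) R := distribution pi bsnd.

Definition couplings (mu : probability (borel X) R)
    (nu : probability (borel Y) R) : set (probability (borel (X * Y)%type) R) :=
  [set pi | marginal1 pi ≡μ mu /\ marginal2 pi ≡μ nu].

End couplings.

(* The derivative may be <= 0, where lne is -oo, only on a pi-null set; the
   negative part of the integrand is always pi-integrable. *)
Definition relative_entropy {R : realType} {disp : measure_display}
    {T : measurableType disp} (pi gamma : probability T R) : \bar R :=
  if `[< pi `<< gamma >] then
    \int[pi]_z lne (('d (charge_of_finite_measure pi) '/d gamma) z)
  else +oo.

(* Half the squared Euclidean distance; `|x - y| on 'rV is the sup norm. *)
Definition quadratic_cost {R : realType} {d : nat} (x y : 'rV[R]_d) : R :=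
  (2^-1 * \sum_(i < d) (x ord0 i - y ord0 i) ^+ 2)%R.

Definition OT {R : realType} {d : nat}
    (mu nu : probability (borel 'rV[R]_d) R) : \bar R :=
  ereal_inf [set \int[kappa]_z (quadratic_cost (bfst z) (bsnd z))%:E
            | kappa in couplings mu nu].

Definition relaxed_objective {R : realType} {d : nat}
    (mu nu : probability (borel 'rV[R]_d) R)
    (gamma : probability (borel ('rV[R]_d * 'rV[R]_d)%type) R) (eps : R)
    (pi : probability (borel ('rV[R]_d * 'rV[R]_d)%type) R) : \bar R :=
  (eps^-1)%:E * OT mu (marginal1 pi) + (eps^-1)%:E * OT nu (marginal2 pi)
  + relative_entropy pi gamma.

Definition is_minimizer {R : realType} {U : Type} (S : set U) (J : U -> \bar R)
    (x : U) : Prop :=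
  S x /\ forall y, S y -> J x <= J y.

(* Elements of [probability T R] carry values on non-measurable sets too, hence
   uniqueness up to equality on the measurable sets. *)
Definition is_unique_minimizer {R : realType} {disp : measure_display}
    {T : measurableType disp} (S : set (probability T R))
    (J : probability T R -> \bar R) (x : probability T R) : Prop :=
  is_minimizer S J x /\ forall y, is_minimizer S J y -> y ≡μ x.

Definition weak_cvg {R : realType} {T : ptopologicalType} {I : Type}
    (F : set_system I) (P : I -> probability (borel T) R)
    (P0 : probability (borel T) R) : Prop :=
  forall f : T -> R, continuous f -> [bounded f x | x in [set: T]] ->
    \int[P i]_x (f x)%:E @[i --> F] --> \int[P0]_x (f x)%:E.

(* Main.v *)
Require Import Defs.
From HB Require Import structures.
From mathcomp Require Import all_boot all_order all_algebra.
From mathcomp Require Import all_classical all_reals all_analysis.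
From mathcomp Require Import giry measurable_realfun ring lra.

(* Every probability P << gamma is described by its density f, and
   H(P | gamma) is the integral of psi(f) = f ln f - f + 1. A small transport
   cost to mu makes the integrals of bounded Lipschitz functions against mu and
   against the marginal close, which is a convex (linear) constraint on f. Over
   these relaxed constraint sets the infima of the entropy increase to a limit
   h; the midpoint of two almost minimizers is again admissible, so the strong
   convexity of psi forces almost minimizers to be close in L1(gamma). By
   completeness of L1 and Fatou they converge to a density that satisfies the
   exact constraints with entropy at most h. It is hence the unique minimizer
   over the couplings, h is the minimal entropy, and the optimizers of the
   relaxed problems converge to it in total variation. *)

Set Implicit Arguments.
Unset Strict Implicit.
Unset Printing Implicit Defensive.

Import Order.TTheory GRing.Theory Num.Theory.
Import numFieldNormedType.Exports.

Local Open Scope classical_set_scope.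
Local Open Scope ring_scope.

(** * The entropy integrand *)

Section entropy_integrand.
Context {R : realType}.
Implicit Types a b x t : R.

(** The correction [- x + 1] integrates to 0 against a density of mass 1 and makes the integrand
    nonnegative, so that its integral always makes sense in the extended reals. At 0 the product
    [x * ln x] is 0, which is also its limit from the right. *)
Definition psi x := x * ln x - x + 1.

Lemma ln_lower x : 0 < x -> 1 - x^-1 <= ln x.
Proof.
move=> x0; have vx0 : 0 < x^-1 by rewrite invr_gt0.
have := @le_ln1Dx R (x^-1 - 1); rewrite addrCA subrr addr0 lnV ?posrE//.
by move=> h; have {h} := h ltac:(lra); lra.
Qed.

Lemma psi_ge0 x : 0 <= x -> 0 <= psi x.
Proof.
rewrite le_eqVlt => /predU1P[<-|x0]; first by rewrite /psi mul0r subr0 add0r.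
have := ler_wpM2l (ltW x0) (ln_lower x0).
rewrite mulrBr mulr1 divff ?gt_eqF// /psi; lra.
Qed.

(* [ln y >= 2 (1 - 1 / sqrt y)] at [y = a / m]. *)
Lemma mul_ln_ratio_ge a m : 0 <= a -> 0 < m ->
  2 * (a - Num.sqrt a * Num.sqrt m) <= a * ln a - a * ln m.
Proof.
rewrite le_eqVlt => /predU1P[<-|a0] m0; first by rewrite sqrtr0 !mul0r; lra.
set p := Num.sqrt a; set q := Num.sqrt m.
have p0 : 0 < p by rewrite sqrtr_gt0.
have q0 : 0 < q by rewrite sqrtr_gt0.
have -> : a = p ^+ 2 by rewrite sqr_sqrtr// ltW.
have -> : m = q ^+ 2 by rewrite sqr_sqrtr// ltW.
have pq : 0 < p / q by rewrite divr_gt0.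
have -> : p ^+ 2 * ln (p ^+ 2) - p ^+ 2 * ln (q ^+ 2) = 2 * p ^+ 2 * ln (p / q).
  by rewrite !lnXn// ln_div ?posrE//; ring.
apply: le_trans (ler_wpM2l _ (ln_lower pq)); last by rewrite mulr_ge0// sqr_ge0.
by rewrite le_eqVlt; apply/orP; left; apply/eqP; field; rewrite !gt_eqF.
Qed.

(** Strong convexity of [psi] in the Hellinger distance. The affine parts of [psi] cancel in the
    midpoint gap, which leaves [a (ln a - ln m) + b (ln b - ln m)]; each summand is bounded below by
    [mul_ln_ratio_ge]. *)
Lemma sqr_sqrtB_le_psi_gap a b : 0 <= a -> 0 <= b ->
  (Num.sqrt a - Num.sqrt b) ^+ 2 <=
  2 * (psi a + psi b - 2 * psi (2^-1 * (a + b))).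
Proof.
move=> a0 b0; set m := 2^-1 * (a + b).
have m0 : 0 <= m by rewrite /m; lra.
move: m0; rewrite le_eqVlt => /predU1P[m0|m0].
  have [-> ->] : a = 0 /\ b = 0 by rewrite /m in m0; split; lra.
  by rewrite -m0 /psi subrr expr0n/=; lra.
have := mul_ln_ratio_ge a0 m0; have := mul_ln_ratio_ge b0 m0; rewrite /psi.
have -> : m * ln m = 2^-1 * (a * ln m + b * ln m) by rewrite /m; ring.
have := sqr_sqrtr a0; have := sqr_sqrtr b0; have := sqr_sqrtr (ltW m0).
set p := Num.sqrt a; set q := Num.sqrt b; set r := Num.sqrt m.
move: (a * ln a) (b * ln b) (a * ln m) (b * ln m) => A B C D.
(* Since [p^2 + q^2 = 2 r^2], the inequality [4 r (p + q) <= (p + q)^2 + 4 r^2] removes [r] and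
   leaves [(p - q)^2]. *)
have := sqr_ge0 (p + q - 2 * r); rewrite !expr2 /m; lra.
Qed.

(** Factor [|a - b|] as [|sqrt a - sqrt b| (sqrt a + sqrt b)] and apply Young's inequality with
    weight [t]: the first factor is controlled by the gap, the square of the second by four times
    the midpoint. The free parameter [t] does the work of Cauchy-Schwarz after integration. *)
Lemma psi_gap a b t : 0 <= a -> 0 <= b -> 0 < t ->
  `|a - b| <= 2 / t * (psi a + psi b - 2 * psi (2^-1 * (a + b)))
              + t * (2^-1 * (a + b)).
Proof.
move=> a0 b0 t0; have := sqr_sqrtB_le_psi_gap a0 b0.
have -> : `|a - b| = `|Num.sqrt a - Num.sqrt b| * (Num.sqrt a + Num.sqrt b).
  rewrite -[X in _ * X]ger0_norm ?addr_ge0 ?sqrtr_ge0// -normrM.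
  by rewrite -subr_sqr !sqr_sqrtr.
have v4 : (Num.sqrt a + Num.sqrt b) ^+ 2 <= 4 * (2^-1 * (a + b)).
  have := sqr_ge0 (Num.sqrt a - Num.sqrt b).
  have := sqr_sqrtr a0; have := sqr_sqrtr b0; rewrite !expr2; lra.
rewrite -real_normK ?num_real//.
move: (psi a + _ - _) (`|_|) (Num.sqrt a + _) v4 => X u v.
move: (2^-1 * _) => m v4 key.
rewrite -(ler_pM2l t0).
have -> : t * (2 / t * X + t * m) = 2 * X + t ^+ 2 * m.
  by field; rewrite gt_eqF.
have := sqr_ge0 (2 * u - t * v).
have : t ^+ 2 * v ^+ 2 <= t ^+ 2 * (4 * m) by rewrite ler_wpM2l// sqr_ge0.
rewrite !expr2 in key *; lra.
Qed.

Lemma cvg_psi (u : nat -> R) x : (forall n, 0 <= u n) -> u @ \oo --> x ->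
  psi (u n) @[n --> \oo] --> psi x.
Proof.
move=> u0 ux.
have x0 : 0 <= x by apply: (cvgr_to_ge ux); exact: nearW.
rewrite /psi; apply: cvgD; last exact: cvg_cst.
apply: cvgB => //.
move: x0; rewrite le_eqVlt => /predU1P[x0|x0]; last first.
  apply: cvgM => //; apply: continuous_cvg => //; exact: continuous_ln.
rewrite -x0 in ux *; rewrite mul0r.
(* [0 <= - y ln y <= 2 sqrt y] for [y] in [(0, 1)]. *)
have bound (y : R) : 0 <= y -> y < 1 -> `|y * ln y| <= 2 * Num.sqrt y.
  rewrite le_eqVlt => /predU1P[<-|y0] y1.
    by rewrite mul0r normr0 mulr_ge0 ?sqrtr_ge0.
  have sy : 0 < Num.sqrt y by rewrite sqrtr_gt0.
  have lny : 2 * (1 - (Num.sqrt y)^-1) <= ln y.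
    rewrite -[X in _ <= ln X](sqr_sqrtr (ltW y0)) lnXn// -[leRHS]mulr_natl ler_wpM2l//.
    exact: ln_lower.
  have ly0 : ln y <= 0 by rewrite ln_le0// ltW.
  rewrite ler0_norm ?mulr_ge0_le0 ?(ltW y0)// -mulrN.
  have : y * - ln y <= y * (2 * (Num.sqrt y)^-1) by rewrite ler_wpM2l ?(ltW y0)//; lra.
  move=> /le_trans; apply; rewrite -[X in X * _](sqr_sqrtr (ltW y0)) mulrCA expr2 -mulrA.
  by rewrite divff ?gt_eqF// mulr1.
have sq0 : 2 * Num.sqrt (u n) @[n --> \oo] --> (0 : R).
  rewrite -[X in _ --> X](mulr0 2); apply: cvgMl_tmp.
  rewrite -[X in _ --> X](@sqrtr0 R).
  by apply: continuous_cvg => //; exact: sqrt_continuous.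
apply: norm_cvg0.
apply: (squeeze_cvgr _ (cvg_cst (0 : R)) sq0).
have /cvgrPdist_lt/(_ 1 ltr01) := ux.
apply: filterS => n; rewrite sub0r normrN ger0_norm// => un1.
by rewrite normr_ge0 bound.
Qed.

End entropy_integrand.

Lemma measurable_psi {R : realType} : measurable_fun [set: R] (@psi R).
Proof.
apply: measurable_funD => //; apply: measurable_funB => //.
by apply: measurable_funM => //; exact: measurable_ln.
Qed.

(** * Fatou's lemma and completeness of L1 *)

Section l1_limits.
Context d (T : measurableType d) (R : realType).
Variable mu : {measure set T -> \bar R}.

Lemma measurable_limn_einf (u : nat -> T -> \bar R) :
  (forall n, measurable_fun [set: T] (u n)) ->
  measurable_fun [set: T] (fun x => limn_einf (u ^~ x)).
Proof.
move=> mu_; rewrite /limn_einf; apply: measurableT_comp => //.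
by apply: measurable_fun_limn_esup => n; exact: measurableT_comp.
Qed.

Lemma limn_einf_ge0 (u : nat -> \bar R) :
  (forall n, 0 <= u n)%E -> (0 <= limn_einf u)%E.
Proof.
move=> u0; rewrite limn_einf_lim; apply: lime_ge; first exact: is_cvg_einfs.
by apply: nearW => n; apply: le_ereal_inf_tmp => _ [m _ <-].
Qed.

Lemma limn_einf_le (u : nat -> \bar R) c :
  (\forall n \near \oo, u n <= c)%E -> (limn_einf u <= c)%E.
Proof.
move=> [N _ uc]; rewrite limn_einf_lim.
apply: lime_le; first exact: is_cvg_einfs.
apply: nearW => n; apply: (@ereal_inf_le _ _ c).
exists (u (maxn n N)); last by apply: uc; exact: leq_maxr.
by exists (maxn n N) => //=; exact: leq_maxl.
Qed.

(** The limit [f] agrees almost everywhere with the pointwise limit inferior, to which Fatou's lemma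
    applies. *)
Lemma fatou_ae (u : nat -> T -> R) (f : T -> R) (c : \bar R) :
  (forall n, measurable_fun [set: T] (u n)) -> (forall n x, 0 <= u n x) ->
  measurable_fun [set: T] f -> (forall x, 0 <= f x) ->
  {ae mu, forall x, u n x @[n --> \oo] --> f x} ->
  (\forall n \near \oo, \int[mu]_x (u n x)%:E <= c)%E ->
  (\int[mu]_x (f x)%:E <= c)%E.
Proof.
move=> mu_ u0 mf f0 uf uc.
have mEu n : measurable_fun [set: T] (EFin \o u n) by exact/measurable_EFinP.
rewrite (@ge0_ae_eq_integral _ _ _ mu setT _
  (fun x => limn_einf (fun n => (u n x)%:E)))//.
- apply: le_trans (fatou mu measurableT mEu _) _ => //.
    by move=> n x _; rewrite lee_fin.
  exact: limn_einf_le.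
- exact/measurable_EFinP.
- exact: measurable_limn_einf.
- by move=> x _; rewrite lee_fin.
- by move=> x _; apply: limn_einf_ge0 => n; rewrite lee_fin.
- apply: filterS uf => x ux _.
  have /cvg_limn_einf_sup[-> _]// : (u n x)%:E @[n --> \oo] --> (f x)%:E.
  by apply: cvg_EFin => //; exact: nearW.
Qed.

(* A rapidly Cauchy subsequence has integrable total variation, hence
   converges almost everywhere. *)
Lemma l1_cauchy_ae_cvg (u : nat -> T -> R) :
  (forall n, measurable_fun [set: T] (u n)) -> (forall n x, 0 <= u n x) ->
  (forall n, \int[mu]_x `|(u n.+1 x - u n x)%:E| <= (1 / (2 ^ n.+1)%:R)%:E)%E ->
  exists f : T -> R, [/\ measurable_fun [set: T] f, (forall x, 0 <= f x) &
    {ae mu, forall x, u n x @[n --> \oo] --> f x}].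
Proof.
move=> mu_ u0 uC.
(* The limit inferior exists and is measurable everywhere; [fine] gives it the value 0 where it is
   infinite. *)
exists (fun x => fine (limn_einf (fun n => (u n x)%:E))).
have md n : measurable_fun [set: T] (fun x => `|(u n.+1 x - u n x)%:E|%E).
  apply: measurableT_comp => //; apply/measurable_EFinP.
  exact: measurable_funB.
split.
- apply: measurableT_comp => //; apply: measurable_limn_einf => n.
  exact/measurable_EFinP.
- by move=> x; apply: fine_ge0; apply: limn_einf_ge0 => n; rewrite lee_fin.
pose G x := (\sum_(n <oo) `|(u n.+1 x - u n x)%:E|)%E.
have iG : mu.-integrable [set: T] G.
  apply/integrableP; split; first exact: ge0_emeasurable_sum.
  under eq_integral do rewrite gee0_abs ?nneseries_ge0//.
  rewrite integral_nneseries//.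
  apply: (@le_lt_trans _ _ 1%E); last exact: ltry.
  apply: le_trans (epsilon_trick0 xpredT ler01).
  by apply: lee_nneseries => // i _ _; exact: integral_ge0.
apply: filterS (integrable_ae measurableT iG) => x /(_ I) Gx.
suff : cvgn (u ^~ x).
  move=> /cvg_ex[l ul].
  have /cvg_limn_einf_sup[-> _]// : (u n x)%:E @[n --> \oo] --> l%:E.
  by apply: cvg_EFin => //; exact: nearW.
(* Where [G x] is finite, the series of increments converges absolutely, and its partial sums are
   [u n x - u 0 x]. *)
have : cvgn (series (telescope (u ^~ x))).
  apply: normed_cvg.
  apply: nondecreasing_is_cvgn.
    by apply: nondecreasing_series => n _ _; exact: normr_ge0.
  exists (fine (G x)) => _ [n _ <-]; rewrite -lee_fin fineK//.
  by rewrite /= -sumEFin; exact: (nneseries_lim_ge n).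
rewrite telescopeK => /cvg_ex[l /= ul]; apply/cvg_ex; exists (l + u 0%N x).
rewrite (_ : u ^~ x = (fun n => u n x - u 0%N x + u 0%N x)); last first.
  by apply/funext => n; rewrite subrK.
by apply: cvgD => //; exact: cvg_cst.
Qed.

Lemma l1_cauchy_cvg (u : nat -> T -> R) :
  (forall n, measurable_fun [set: T] (u n)) -> (forall n x, 0 <= u n x) ->
  (forall e : R, 0 < e -> exists N, forall n m, (N <= n)%N -> (N <= m)%N ->
    (\int[mu]_x `|u n x - u m x|%:E <= e%:E)%E) ->
  exists f : T -> R, [/\ measurable_fun [set: T] f, (forall x, 0 <= f x),
    (exists s : nat -> nat, (forall n, (n <= s n)%N) /\
      {ae mu, forall x, u (s n) x @[n --> \oo] --> f x}) &
    forall e : R, 0 < e -> exists N, forall n, (N <= n)%N ->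
      (\int[mu]_x `|u n x - f x|%:E <= e%:E)%E].
Proof.
move=> mu_ u0 uC.
have /choice[s0 s0P] : forall k, exists N, forall n m, (N <= n)%N -> (N <= m)%N ->
    (\int[mu]_x `|u n x - u m x|%:E <= (1 / (2 ^ k.+1)%:R)%:E)%E.
  by move=> k; apply: uC; rewrite divr_gt0// ltr0n expn_gt0.
(* Summing the thresholds makes [s] nondecreasing and at least [s0 k]; the extra [k] makes it tend
   to infinity. *)
pose s k := (k + \sum_(i < k.+1) s0 i)%N.
have s0s k : (s0 k <= s k)%N by rewrite /s big_ord_recr/= addnA leq_addl.
have sS k : (s k <= s k.+1)%N.
  by rewrite /s [X in (_ <= _ + X)%N]big_ord_recr/= leq_add// leq_addr.
have ks k : (k <= s k)%N by rewrite leq_addr.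
have [f [mf f0 uf]] := @l1_cauchy_ae_cvg (u \o s) (fun n => mu_ _) (fun n => u0 _)
  (fun k => s0P k _ _ (leq_trans (s0s k) (sS k)) (s0s k)).
exists f; split => //; first by exists s.
move=> e e0; have [N NP] := uC _ e0; exists N => n Nn.
(* Fatou in the second index of the Cauchy estimate turns convergence along the subsequence into L1
   convergence of the whole sequence. *)
apply: (@fatou_ae (fun k x => `|u n x - u (s k) x|)).
- by move=> k; apply: measurableT_comp => //; exact: measurable_funB.
- by move=> k x; exact: normr_ge0.
- by apply: measurableT_comp => //; exact: measurable_funB.
- by move=> x; exact: normr_ge0.
- apply: filterS uf => x ux; apply: cvg_norm; apply: cvgB => //; exact: cvg_cst.
- exists N => // k /= Nk; apply: NP => //; exact: leq_trans (ks k).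
Qed.

End l1_limits.

(** * Densities *)

Lemma EFin_Rintegral d (T : measurableType d) (R : realType)
    (mu : {measure set T -> \bar R}) (f : T -> R) :
  mu.-integrable [set: T] (EFin \o f) ->
  (\int[mu]_x (f x)%:E = (\int[mu]_x f x)%:E)%E.
Proof. by move=> fi; rewrite fineK// integrable_fin_num. Qed.

Section densities.
Context d (T : measurableType d) (R : realType) (gamma : probability T R).
Implicit Types f g : T -> R.

Definition pdf f := [/\ measurable_fun [set: T] f, (forall x, 0 <= f x) &
  (\int[gamma]_x (f x)%:E = 1)%E].

Definition entropy f := (\int[gamma]_x (psi (f x))%:E)%E.

Definition midpoint f g := fun x => 2^-1 * (f x + g x).

Lemma integrable_ge0 f : measurable_fun [set: T] f -> (forall x, 0 <= f x) ->
  (\int[gamma]_x (f x)%:E < +oo)%E -> gamma.-integrable [set: T] (EFin \o f).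
Proof.
move=> mf f0 fy; apply/integrableP; split; first exact/measurable_EFinP.
by under eq_integral do rewrite /= ger0_norm//.
Qed.

Lemma pdf_integrable f : pdf f -> gamma.-integrable [set: T] (EFin \o f).
Proof. by move=> [mf f0 f1]; apply: integrable_ge0 => //; rewrite f1 ltry. Qed.

Lemma measurable_psi_comp f : measurable_fun [set: T] f ->
  measurable_fun [set: T] (psi \o f).
Proof. by move=> mf; apply: measurableT_comp => //; exact: measurable_psi. Qed.

Lemma entropy_integrable f : pdf f -> (entropy f < +oo)%E ->
  gamma.-integrable [set: T] (EFin \o (psi \o f)).
Proof.
move=> [mf f0 _] fy; apply: integrable_ge0 => //; first exact: measurable_psi_comp.
by move=> x; exact: psi_ge0.
Qed.

Lemma entropy_ge0 f : pdf f -> (0 <= entropy f)%E.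
Proof.
by move=> [_ f0 _]; apply: integral_ge0 => x _; rewrite lee_fin psi_ge0.
Qed.

Lemma integrable_dist f g : gamma.-integrable [set: T] (EFin \o f) ->
  gamma.-integrable [set: T] (EFin \o g) ->
  gamma.-integrable [set: T] (EFin \o (fun x => `|f x - g x|)).
Proof.
move=> fi gi; apply: (@integrable_norm _ _ _ _ _ (fun x => f x - g x)).
exact: (integrableB measurableT fi gi).
Qed.

Lemma integrable_bounded_mul (h : T -> R) M f : measurable_fun [set: T] h ->
  (forall x, `|h x| <= M) -> gamma.-integrable [set: T] (EFin \o f) ->
  gamma.-integrable [set: T] (EFin \o (fun x => h x * f x)).
Proof.
move=> mh hM fi.
have := integrableZl measurableT M fi; apply: le_integrable => //.
  apply/measurable_EFinP; apply: measurable_funM => //.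
  by apply/measurable_EFinP; exact: measurable_int fi.
move=> x _; rewrite /= !lee_fin !normrM ler_wpM2r//.
exact: le_trans (hM x) (ler_norm _).
Qed.

Lemma dist_bounded_moment (h : T -> R) M f g : measurable_fun [set: T] h ->
  (forall x, `|h x| <= M) -> gamma.-integrable [set: T] (EFin \o f) ->
  gamma.-integrable [set: T] (EFin \o g) ->
  `|(\int[gamma]_x (h x * f x)) - (\int[gamma]_x (h x * g x))| <=
  M * (\int[gamma]_x `|f x - g x|).
Proof.
move=> mh hM fi gi.
have hf := integrable_bounded_mul mh hM fi.
have hg := integrable_bounded_mul mh hM gi.
rewrite -RintegralB// -RintegralZl//; last exact: integrable_dist.
apply: le_trans.
  apply: le_normr_Rintegral => //.
  exact: (integrableB measurableT hf hg).
apply: le_Rintegral => //.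
- exact: integrable_dist.
- exact: (integrableZl measurableT M (integrable_dist fi gi)).
by move=> x _; rewrite -mulrBr normrM ler_wpM2r.
Qed.

Lemma midpoint_pdf f g : pdf f -> pdf g -> pdf (midpoint f g).
Proof.
move=> pf pg; have [[mf f0 f1] [mg g0 g1]] := (pf, pg).
split.
- by apply: measurable_funM => //; exact: measurable_funD.
- by move=> x; rewrite mulr_ge0// addr_ge0.
under eq_integral do rewrite EFinM EFinD.
rewrite ge0_integralZl//; last 2 first.
- by apply: emeasurable_funD; exact/measurable_EFinP.
- by move=> x _; rewrite adde_ge0// lee_fin.
rewrite ge0_integralD//; [|by move=> x _; rewrite lee_fin|exact/measurable_EFinP
  |by move=> x _; rewrite lee_fin|exact/measurable_EFinP].
by rewrite f1 g1 -EFinD -EFinM mulVf.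
Qed.

Lemma psi_midpoint_le f g x : 0 <= f x -> 0 <= g x ->
  psi (midpoint f g x) <= 2^-1 * (psi (f x) + psi (g x)).
Proof.
move=> f0 g0; have := sqr_sqrtB_le_psi_gap f0 g0.
have := sqr_ge0 (Num.sqrt (f x) - Num.sqrt (g x)); rewrite /midpoint; lra.
Qed.

Lemma midpoint_entropy_lty f g : pdf f -> pdf g ->
  (entropy f < +oo)%E -> (entropy g < +oo)%E -> (entropy (midpoint f g) < +oo)%E.
Proof.
move=> pf pg fy gy; have [[mf f0 _] [mg g0 _]] := (pf, pg).
have [mm m0 _] := midpoint_pdf pf pg.
have : gamma.-integrable [set: T] (EFin \o (fun x => 2^-1 * (psi (f x) + psi (g x)))).
  apply: (integrableZl measurableT 2^-1
    (integrableD measurableT (entropy_integrable pf fy) (entropy_integrable pg gy))).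
move=> /integrableP[_]; apply: le_lt_trans; apply: ge0_le_integral => //.
- by move=> x _; rewrite lee_fin psi_ge0.
- by apply/measurable_EFinP; exact: measurable_psi_comp.
- apply: measurableT_comp => //; apply/measurable_EFinP.
  by apply: measurable_funM => //; apply: measurable_funD; exact: measurable_psi_comp.
- by move=> x _; rewrite lee_fin (le_trans (psi_midpoint_le _ _))// ler_norm.
Qed.

(** Integrate [psi_gap]; the midpoint is again a density of mass 1, so the last term integrates to
    [t]. *)
Lemma l1_le_entropy_gap f g t : pdf f -> pdf g ->
  (entropy f < +oo)%E -> (entropy g < +oo)%E -> 0 < t ->
  \int[gamma]_x `|f x - g x| <=
  2 / t * ((\int[gamma]_x psi (f x)) + (\int[gamma]_x psi (g x))
           - 2 * (\int[gamma]_x psi (midpoint f g x))) + t.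
Proof.
move=> pf pg fy gy t0.
have pm := midpoint_pdf pf pg; have my := midpoint_entropy_lty pf pg fy gy.
have [[mf f0 _] [mg g0 _] [mm m0 m1]] := And3 pf pg pm.
have If := entropy_integrable pf fy.
have Ig := entropy_integrable pg gy.
have Im := entropy_integrable pm my.
have I1 : gamma.-integrable [set: T] (EFin \o (fun x => psi (f x) + psi (g x))).
  exact: (integrableD measurableT If Ig).
have I2 : gamma.-integrable [set: T] (EFin \o (fun x => 2 * psi (midpoint f g x))).
  exact: (integrableZl measurableT 2 Im).
have I3 : gamma.-integrable [set: T] (EFin \o (fun x =>
    psi (f x) + psi (g x) - 2 * psi (midpoint f g x))).
  exact: (integrableB measurableT I1 I2).
have I4 : gamma.-integrable [set: T] (EFin \o (fun x =>
    2 / t * (psi (f x) + psi (g x) - 2 * psi (midpoint f g x)))).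
  exact: (integrableZl measurableT (2 / t) I3).
have I5 : gamma.-integrable [set: T] (EFin \o (fun x => t * midpoint f g x)).
  exact: (integrableZl measurableT t (pdf_integrable pm)).
have int1 : \int[gamma]_x midpoint f g x = 1 by rewrite /Rintegral m1.
have int2 : t = \int[gamma]_x (t * midpoint f g x).
  by rewrite RintegralZl ?int1 ?mulr1//; exact: pdf_integrable.
rewrite [X in _ <= _ + X]int2.
rewrite -(RintegralD measurableT If Ig) -(RintegralZl 2 measurableT Im).
rewrite -(RintegralB measurableT I1 I2) -(RintegralZl (2 / t) measurableT I3).
rewrite -(RintegralD measurableT I4 I5).
apply: le_Rintegral => //.
- by apply: integrable_dist; exact: pdf_integrable.
- exact: (integrableD measurableT I4 I5).
by move=> x _; exact: psi_gap.
Qed.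

End densities.

(** * Entropy projection *)

Section entropy_projection.
Context d (T : measurableType d) (R : realType) (gamma : probability T R).
(** A pair in [S] is a test function together with the prescribed value of its integral against the
    unknown density. *)
Variable S : set ((T -> R) * R).
Hypothesis SP : forall p, S p ->
  measurable_fun [set: T] p.1 /\ forall x, `|p.1 x| <= 1.

Definition moment_set (delta : R) : set (T -> R) := [set f | pdf gamma f /\
  forall p, S p -> `|(\int[gamma]_x (p.1 x * f x)) - p.2| <= delta].

Lemma moment_setS a b : a <= b -> moment_set a `<=` moment_set b.
Proof. by move=> ab f [pf fa]; split=> // p /fa /le_trans; apply. Qed.

(** Moments are linear in the density, so each constraint confines an affine function to an interval
    and is convex. *)
Lemma midpoint_moment_set a f g : moment_set a f -> moment_set a g ->
  moment_set a (midpoint f g).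
Proof.
move=> [pf fa] [pg ga]; split; first exact: midpoint_pdf.
move=> p Sp; have [mp p1] := SP Sp.
have If := integrable_bounded_mul mp p1 (pdf_integrable pf).
have Ig := integrable_bounded_mul mp p1 (pdf_integrable pg).
have -> : \int[gamma]_x (p.1 x * midpoint f g x) =
    2^-1 * (\int[gamma]_x (p.1 x * f x) + \int[gamma]_x (p.1 x * g x)).
  rewrite -(RintegralD measurableT If Ig).
  rewrite -(RintegralZl 2^-1 measurableT (integrableD measurableT If Ig)).
  by apply: eq_Rintegral => x _; rewrite /midpoint; ring.
have := fa _ Sp; have := ga _ Sp; rewrite !ler_norml; lra.
Qed.

Let finite_entropy (delta : R) : set (T -> R) :=
  [set f | moment_set delta f /\ (entropy gamma f < +oo)%E].

Let J f := \int[gamma]_x psi (f x).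

Let entropyE delta f : finite_entropy delta f -> entropy gamma f = (J f)%:E.
Proof. by move=> [[pf _] fy]; rewrite -EFin_Rintegral//; exact: entropy_integrable. Qed.

Let J_ge0 delta f : finite_entropy delta f -> 0 <= J f.
Proof.
by move=> Ff; rewrite -lee_fin -(entropyE Ff) entropy_ge0//; case: Ff => -[].
Qed.

Variable fs : T -> R.
Hypotheses (fsK : moment_set 0 fs) (fsy : (entropy gamma fs < +oo)%E).

(** These infima increase as the tolerance shrinks and are bounded by [J fs]; their supremum [hoo]
    below will turn out to be the entropy of the projection. *)
Let h n := inf (J @` finite_entropy n.+1%:R^-1).

Let fs_finite delta : 0 <= delta -> finite_entropy delta fs.
Proof. by move=> d0; split => //; exact: moment_setS fsK. Qed.

Let natV_ge0 n : 0 <= n.+1%:R^-1 :> R. Proof. by rewrite invr_ge0. Qed.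

Let h_lb n f : finite_entropy n.+1%:R^-1 f -> h n <= J f.
Proof.
move=> Ff; apply: ge_inf; last by exists f.
by exists 0 => _ [g /J_ge0 ? <-].
Qed.

Let hoo := sup (range h).

Let h_has_sup : has_sup (range h).
Proof.
split; first by exists (h 0%N); exists 0%N.
by exists (J fs) => _ [n _ <-]; apply: h_lb; exact: fs_finite.
Qed.

Let h_le_hoo n : h n <= hoo.
Proof. by apply: ub_le_sup; [exact: h_has_sup.2|exists n]. Qed.

Let almost_minimizer n :
  exists f, finite_entropy n.+1%:R^-1 f /\ J f <= hoo + n.+1%:R^-1.
Proof.
have hi : has_inf (J @` finite_entropy n.+1%:R^-1).
  split; first by exists (J fs); exists fs => //; exact: fs_finite.
  by exists 0 => _ [g /J_ge0 ? <-].
have n0 : (0 : R) < n.+1%:R^-1 by rewrite invr_gt0.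
have [_ [f Ff <-] Jf] := inf_adherent n0 hi.
by exists f; split => //; rewrite (le_trans (ltW Jf))// lerD2r h_le_hoo.
Qed.

(** The midpoint of two almost minimizers is admissible at the same tolerance, so its entropy is at
    least [h N > hoo - eta]. The convexity gap is then at most [4 * eta], and [l1_le_entropy_gap]
    bounds the L1 distance. *)
Let modulus (e : R) : 0 < e -> exists N eta, [/\ 0 < eta :> R & forall f g,
  finite_entropy N.+1%:R^-1 f -> finite_entropy N.+1%:R^-1 g ->
  J f <= hoo + eta -> J g <= hoo + eta -> \int[gamma]_x `|f x - g x| <= e].
Proof.
(* Chosen so that with [t = e / 2] the gap term [2 / t * (4 * eta)] is [e / 2], the same as the
   remaining term [t]. *)
move=> e0; pose eta := e ^+ 2 / 32.
have eta0 : 0 < eta by rewrite divr_gt0// exprn_gt0.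
have [_ [N _ <-] hN] := sup_adherent eta0 h_has_sup.
exists N, eta; split => // f g Ff Fg Jf Jg.
have [[[Mf fy] [Mg gy]] e2] := (Ff, Fg, divr_gt0 e0 (ltr0Sn R 1)).
apply: le_trans (l1_le_entropy_gap Mf.1 Mg.1 fy gy e2) _.
have hm : h N <= J (midpoint f g).
  apply: h_lb; split; first exact: midpoint_moment_set.
  by apply: midpoint_entropy_lty => //; [exact: Mf.1|exact: Mg.1].
rewrite -/(J f) -/(J g) -/(J (midpoint f g)).
have : 2 / (e / 2) * (J f + J g - 2 * J (midpoint f g)) <= 2 / (e / 2) * (4 * eta).
  by apply: ler_wpM2l; [rewrite divr_ge0// ltW|rewrite -/hoo in hN; lra].
have -> : 2 / (e / 2) * (4 * eta) = e / 2.
  by rewrite /eta; field; rewrite gt_eqF.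
lra.
Qed.

(** By [modulus], almost minimizers at tolerances tending to 0 form a Cauchy sequence. The last
    clause is what yields both uniqueness and convergence: [f0] is an almost minimizer at every
    tolerance, so [modulus] also compares it with any competitor of no larger entropy. *)
Lemma entropy_projection : exists f0, [/\ moment_set 0 f0,
  (entropy gamma f0 < +oo)%E,
  forall f, moment_set 0 f -> (entropy gamma f0 <= entropy gamma f)%E &
  forall e : R, 0 < e -> exists2 delta : R, 0 < delta & forall f,
    moment_set delta f -> (entropy gamma f <= entropy gamma f0)%E ->
    (\int[gamma]_x `|f x - f0 x|%:E <= e%:E)%E].
Proof.
have /choice[u uP] := almost_minimizer.
have up n : pdf gamma (u n) by case: (uP n) => -[[]].
have ui n := pdf_integrable (up n).
have uF n m : (n <= m)%N -> finite_entropy n.+1%:R^-1 (u m).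
  move=> nm; have [[um uy] _] := uP m; split => //; apply: moment_setS um.
  by rewrite lef_pV2 ?posrE// ler_nat.
have uJ n m : (n <= m)%N -> J (u m) <= hoo + n.+1%:R^-1.
  move=> nm; have [_] := uP m; move=> /le_trans; apply.
  by rewrite lerD2l lef_pV2 ?posrE// ler_nat.
have smallV (e : R) : 0 < e -> exists N, N.+1%:R^-1 <= e :> R.
  move=> e0; have [N _ /(_ N (leqnn N))/ltW NP] := near_infty_natSinv_lt (PosNum e0).
  by exists N.
have [f0 [mf0 f0_ge0 [s [ns us]] uf0]] : exists f : T -> R,
    [/\ measurable_fun [set: T] f, (forall x, 0 <= f x),
    (exists s : nat -> nat, (forall n, (n <= s n)%N) /\
      {ae gamma, forall x, u (s n) x @[n --> \oo] --> f x}) &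
    forall e : R, 0 < e -> exists N, forall n, (N <= n)%N ->
      (\int[gamma]_x `|u n x - f x|%:E <= e%:E)%E].
  apply: l1_cauchy_cvg => [n|n x|e e0]; [by case: (up n)|by case: (up n)|].
  have [N [eta [eta0 NP]]] := modulus e0; have [M Me] := smallV _ eta0.
  exists (maxn N M) => n m; rewrite !geq_max => /andP[Nn Mn] /andP[Nm Mm].
  rewrite EFin_Rintegral; last exact: integrable_dist.
  rewrite lee_fin; apply: NP; try exact: uF.
    by rewrite (le_trans (uJ _ _ Mn))// lerD2l.
  by rewrite (le_trans (uJ _ _ Mm))// lerD2l.
(* Dominate [f0] by [u N + |u N - f0|] for one [N] with finite L1 distance. *)
have f0i : gamma.-integrable [set: T] (EFin \o f0).
  have [N /(_ N (leqnn N)) NP] := uf0 _ ltr01.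
  have di : gamma.-integrable [set: T] (EFin \o (fun x => `|u N x - f0 x|)).
    apply: integrable_ge0 => [|x|]; last exact: le_lt_trans NP (ltry _).
      by apply: measurableT_comp => //; apply: measurable_funB => //; case: (up N).
    exact: normr_ge0.
  apply: le_integrable (integrableD measurableT (ui N) di) => //.
    exact/measurable_EFinP.
  move=> x _ /=; rewrite lee_fin (ger0_norm (f0_ge0 x)) ger0_norm.
    have := ler_norm (f0 x - u N x); rewrite distrC; lra.
  by rewrite addr_ge0//; case: (up N).
have uf0R (e : R) : 0 < e -> exists N, forall n, (N <= n)%N ->
    \int[gamma]_x `|u n x - f0 x| <= e.
  move=> e0; have [N NP] := uf0 _ e0; exists N => n /NP.
  by rewrite EFin_Rintegral//; exact: integrable_dist.
(* Stated for an arbitrary bounded [p], since it serves twice: the constant 1 gives the total mass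
   of [f0], the elements of [S] give its moments. *)
have lim_moment (p : T -> R) m : measurable_fun [set: T] p ->
    (forall x, `|p x| <= 1) -> (forall n,
    `|(\int[gamma]_x (p x * u n x)) - m| <= n.+1%:R^-1) ->
    \int[gamma]_x (p x * f0 x) = m.
  move=> mp p1 pm; apply/eqP; rewrite -subr_eq0 -normr_le0.
  apply/ler_addgt0Pr => e e0; rewrite add0r.
  have e20 : 0 < e / 2 by rewrite divr_gt0.
  have [N NP] := uf0R _ e20; have [M Me] := smallV _ e20.
  have := dist_bounded_moment mp p1 (ui (maxn N M)) f0i.
  have := NP _ (leq_maxl N M).
  have : `|(\int[gamma]_x (p x * u (maxn N M) x)) - m| <= e / 2.
    apply: le_trans (pm _) _; apply: le_trans Me.
    by rewrite lef_pV2 ?posrE// ler_nat ltnS leq_maxr.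
  rewrite mul1r !ler_norml; lra.
have f0K : moment_set 0 f0.
  split.
    split => //; rewrite EFin_Rintegral//; congr (_%:E).
    have one_mul (v : T -> R) :
        \int[gamma]_x v x = \int[gamma]_x (cst 1 x * v x).
      by apply: eq_Rintegral => x _; rewrite mul1r.
    rewrite one_mul; apply: (lim_moment (cst 1)) => [//|x|n].
      by rewrite normr1.
    rewrite -one_mul (_ : \int[gamma]_x u n x = 1) ?subrr ?normr0//.
    by rewrite /Rintegral; have [_ _ ->] := up n.
  move=> p Sp; have [mp p1] := SP Sp.
  rewrite (lim_moment p.1 p.2)// ?subrr ?normr0// => n.
  by have [[[_ /(_ _ Sp)]]] := uP n.
(* Lower semicontinuity: Fatou along the almost everywhere convergent subsequence, with [psi]
   continuous on the half-line including 0. *)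
have f0_hoo : (entropy gamma f0 <= hoo%:E)%E.
  apply/lee_addgt0Pr => e e0; have [N Ne] := smallV _ e0.
  apply: (@fatou_ae _ _ _ gamma (fun n x => psi (u (s n) x)) (fun x => psi (f0 x))).
  - by move=> n; apply: measurable_psi_comp; case: (up (s n)).
  - by move=> n x; apply: psi_ge0; case: (up (s n)).
  - exact: measurable_psi_comp.
  - by move=> x; exact: psi_ge0.
  - by apply: filterS us => x; apply: cvg_psi => n; case: (up (s n)).
  - exists N => // n /= Nn; rewrite -/(entropy gamma (u (s n))).
    have Ns := leq_trans Nn (ns n).
    rewrite (entropyE (uF _ _ Ns)) -EFinD lee_fin.
    by rewrite (le_trans (uJ _ _ Ns))// lerD2l.
have f0y := le_lt_trans f0_hoo (ltry _).
have f0F delta : 0 <= delta -> finite_entropy delta f0.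
  by move=> d0; split => //; exact: moment_setS f0K.
(* A density that meets the constraints exactly competes in every [h n], hence bounds their
   supremum. *)
have hoo_le f : moment_set 0 f -> (entropy gamma f < +oo)%E -> hoo <= J f.
  move=> fK fy; apply: ge_sup; first exact: h_has_sup.1.
  by move=> _ [n _ <-]; apply: h_lb; split => //; exact: moment_setS fK.
exists f0; split => // [f fK|e e0].
  have [->|] := eqVneq (entropy gamma f) +oo%E; first exact: leey.
  rewrite -ltey => fy; apply: le_trans f0_hoo _.
  by rewrite (@entropyE 0 f)// lee_fin hoo_le.
have [N [eta [eta0 NP]]] := modulus e0.
have Jf0 : J f0 <= hoo by rewrite -lee_fin -(entropyE (f0F _ (lexx 0))).
exists N.+1%:R^-1; first by rewrite invr_gt0.
move=> f fK ff0; have fF : finite_entropy N.+1%:R^-1 f.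
  by split => //; exact: le_lt_trans f0y.
rewrite EFin_Rintegral; last by apply: integrable_dist => //; exact: pdf_integrable fK.1.
rewrite lee_fin; apply: NP => //; first exact: f0F.
  by move: ff0; rewrite (entropyE fF) (entropyE (f0F _ (lexx 0)))// lee_fin; lra.
lra.
Qed.

End entropy_projection.

(** * Probabilities with a density *)

Section density_measure.
Context d (T : measurableType d) (R : realType) (gamma : probability T R).
Variables (f : T -> R) (pf : pdf gamma f).

Definition density_measure (A : set T) := (\int[gamma]_(x in A) (f x)%:E)%E.

Let density_measure0 : density_measure set0 = 0%E.
Proof. exact: integral_set0. Qed.

Let density_measure_ge0 A : (0 <= density_measure A)%E.
Proof. by apply: integral_ge0 => x _; rewrite lee_fin; case: pf. Qed.

Let density_measure_sigma_additive : semi_sigma_additive density_measure.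
Proof.
apply: semi_sigma_additive_nng_induced => [|x].
  by apply/measurable_EFinP; case: pf.
by rewrite lee_fin; case: pf.
Qed.

HB.instance Definition _ := isMeasure.Build _ _ _ density_measure
  density_measure0 density_measure_ge0 density_measure_sigma_additive.

Let density_measureT : density_measure [set: T] = 1%E.
Proof. by case: pf. Qed.

HB.instance Definition _ :=
  Measure_isProbability.Build _ _ _ density_measure density_measureT.

Definition density_probability : probability T R := density_measure.

End density_measure.

Section has_density.
Context d (T : measurableType d) (R : realType) (gamma : probability T R).
Implicit Types (P : probability T R) (f : T -> R).
Local Open Scope charge_scope.

(** A real-valued representative that is nonnegative everywhere, whereas the Radon-Nikodym
    derivative is extended-real-valued and has a sign only almost everywhere. *)
Definition has_density P f := [/\ measurable_fun [set: T] f, (forall x, 0 <= f x) &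
  forall A, measurable A -> (P A = \int[gamma]_(x in A) (f x)%:E)%E].

Lemma has_density_pdf P f : has_density P f -> pdf gamma f.
Proof. by move=> [mf f0 Pf]; split => //; rewrite -Pf// probability_setT. Qed.

Lemma density_probabilityP f (pf : pdf gamma f) :
  has_density (density_probability pf) f.
Proof. by have [mf f0 _] := pf; split. Qed.

Lemma has_density_dominates P f : has_density P f -> (P `<< gamma)%E.
Proof.
move=> [mf f0 Pf]; apply/null_content_dominatesP => A mA gA.
by rewrite Pf//; apply: null_set_integral => //; exact/measurable_EFinP/measurable_funTS.
Qed.

Lemma dominated_has_density P : (P `<< gamma)%E -> exists f, has_density P f.
Proof.
(* This version of the derivative is nonnegative and finite at every point, so [fine] loses
   nothing. *)
move=> Pg; pose D := Radon_Nikodym_SigmaFinite.f P gamma.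
have Df x : D x \is a fin_num by exact: Radon_Nikodym_SigmaFinite.f_fin_num.
exists (fine \o D); split.
- apply: measurableT_comp => //.
  exact: measurable_int (Radon_Nikodym_SigmaFinite.f_integrable Pg).
- by move=> x; apply: fine_ge0; exact: Radon_Nikodym_SigmaFinite.f_ge0.
move=> A mA; rewrite (Radon_Nikodym_SigmaFinite.f_integral Pg)//.
by apply: eq_integral => x _; rewrite /= fineK//; exact: Df.
Qed.

Lemma has_density_ae_eq P f : has_density P f ->
  ae_eq gamma [set: T] (EFin \o f) ('d (charge_of_finite_measure P) '/d gamma).
Proof.
move=> Pf; have PG := has_density_dominates Pf; have pf := has_density_pdf Pf.
apply: integral_ae_eq => //; first exact: pdf_integrable.
by move=> A _ mA; rewrite -Radon_Nikodym_integral//=; case: Pf => _ _ <-.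
Qed.

Lemma ge0_integral_has_density P f (h : T -> \bar R) : has_density P f ->
  measurable_fun [set: T] h -> (forall x, 0 <= h x)%E ->
  (\int[P]_x h x = \int[gamma]_x (h x * (f x)%:E))%E.
Proof.
move=> Pf mh h0; have PG := has_density_dominates Pf.
rewrite -(Radon_Nikodym_SigmaFinite.change_of_variables PG h0 measurableT mh).
apply: ae_eq_integral => //.
- apply: emeasurable_funM => //.
  exact: measurable_int (Radon_Nikodym_SigmaFinite.f_integrable PG).
- by apply: emeasurable_funM => //; apply/measurable_EFinP; case: Pf.
- have := ae_eq_trans (ae_eq_Radon_Nikodym_SigmaFinite PG measurableT)
    (ae_eq_sym (has_density_ae_eq Pf)).
  by apply: filterS => x /(_ I) /= -> _.
Qed.

Lemma integral_bounded_has_density P f (h : T -> R) M : has_density P f ->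
  measurable_fun [set: T] h -> (forall x, `|h x| <= M) ->
  (\int[P]_x (h x)%:E = (\int[gamma]_x (h x * f x)%R)%:E)%E.
Proof.
move=> Pf mh hM; have PG := has_density_dominates Pf.
have fi := pdf_integrable (has_density_pdf Pf).
rewrite -EFin_Rintegral; last exact: integrable_bounded_mul hM fi.
have hi : P.-integrable [set: T] (EFin \o h).
  apply: measurable_bounded_integrable => //.
    by rewrite -ge0_fin_numE// fin_num_measure.
  by exists M; split; [exact: num_real|move=> x /ltW Mx y _; exact: le_trans Mx].
rewrite -(Radon_Nikodym_change_of_variables PG measurableT hi).
apply: ae_eq_integral => //.
- apply: emeasurable_funM => //; exact/measurable_EFinP.
- apply/measurable_EFinP; apply: measurable_funM => //; by case: Pf.
- by apply: filterS (has_density_ae_eq Pf) => x /(_ I) /= <- _; rewrite EFinM.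
Qed.

Lemma dominates_ae P (Q : T -> Prop) : (P `<< gamma)%E ->
  {ae gamma, forall x, Q x} -> {ae P, forall x, Q x}.
Proof.
move=> /null_content_dominatesP PG [N [mN N0 QN]].
by exists N; split => //; exact: PG.
Qed.

(** The mass that [P] gives to the zero set of [f] is the integral of [f] over it. This makes the
    value [-oo] of [lne] at 0 harmless. *)
Lemma has_density_gt0_ae P f : has_density P f -> {ae P, forall x, 0 < f x}.
Proof.
move=> [mf f0 Pf]; have mN : measurable [set x | f x <= 0].
  rewrite -[X in measurable X]setTI.
  have -> : [set x | f x <= 0] = f @^-1` `]-oo, 0].
    by apply/seteqP; split => x /=; rewrite in_itv.
  exact: mf.
exists [set x | f x <= 0]; split => //.
  by rewrite Pf//; apply: integral0_eq => x fx; rewrite (@le_anti _ _ (f x) 0) ?fx ?f0.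
by move=> x /= /negP; rewrite -leNgt.
Qed.

(** Write [ln f = a - b] with positive and negative parts. The integral of [b f] is finite, and
    [psi f + f + b f = a f + 1] pointwise. All terms of this identity are nonnegative, so it can be
    integrated even when the entropy is infinite. *)
Lemma relative_entropy_has_density P f : has_density P f ->
  relative_entropy P gamma = entropy gamma f.
Proof.
move=> Pf; have PG := has_density_dominates Pf; have [mf f0 _] := Pf.
have [_ _ f1] := has_density_pdf Pf.
rewrite /relative_entropy asboolT//; set D := ('d _ '/d gamma).
have mD : measurable_fun [set: T] D.
  exact: measurable_int (Radon_Nikodym_integrable _).
have Dfin x : D x \is a fin_num by exact: Radon_Nikodym_fin_num.
have mln : measurable_fun [set: T] (fun x => ln (f x)).
  by apply: measurableT_comp => //; exact: measurable_ln.
transitivity (\int[P]_x (ln (f x))%:E)%E.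
  apply: ae_eq_integral => //.
  (* On finite arguments [lne] is a case distinction, which gives measurability. *)
  - have -> : (fun x => lne (D x)) =
        (fun x => if (fine (D x) <= 0)%R then -oo%E else (ln (fine (D x)))%:E).
      by apply/funext => x; rewrite -{1}(fineK (Dfin x)).
    have mfD : measurable_fun [set: T] (fun x => fine (D x)).
      exact: measurableT_comp.
    apply: measurable_fun_ifT => //; first exact: measurable_fun_ler.
    by apply/measurable_EFinP; apply: measurableT_comp => //; exact: measurable_ln.
  - exact/measurable_EFinP.
  - have := dominates_ae PG (has_density_ae_eq Pf).
    apply: filterS2 (has_density_gt0_ae Pf) => x fx /(_ I) fD _.
    by rewrite /D/= -fD lne_EFin.
rewrite integralE.
pose a x := Num.max (ln (f x)) 0; pose b x := Num.max (- ln (f x)) 0.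
have ma : measurable_fun [set: T] a by apply: measurable_maxr.
have mb : measurable_fun [set: T] b.
  by apply: measurable_maxr => //; exact: measurableT_comp.
have a0 x : 0 <= a x by rewrite le_max lexx orbT.
have b0 x : 0 <= b x by rewrite le_max lexx orbT.
have -> : (\int[P]_x (fun x => (ln (f x))%:E)^\+ x =
    \int[gamma]_x (a x * f x)%:E)%E.
  rewrite (eq_integral (fun x => (a x)%:E)); last first.
    by move=> x _; rewrite funeposE /a EFin_max.
  by rewrite (ge0_integral_has_density Pf)//; exact/measurable_EFinP.
have -> : (\int[P]_x (fun x => (ln (f x))%:E)^\- x =
    \int[gamma]_x (b x * f x)%:E)%E.
  rewrite (eq_integral (fun x => (b x)%:E)); last first.
    by move=> x _; rewrite funenegE /b EFin_max EFinN.
  by rewrite (ge0_integral_has_density Pf)//; exact/measurable_EFinP.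
(* From [- ln y <= y^-1 - 1] for positive [y]; at [f x = 0] the product vanishes. *)
have bf1 x : b x * f x <= 1.
  have [fx|fx] := leP (f x) 0.
    by rewrite (@le_anti _ _ (f x) 0) ?fx ?f0// mulr0.
  rewrite -ler_pdivlMr// div1r ge_max invr_ge0 f0 andbT.
  by have := ln_lower fx; lra.
have mbf : measurable_fun [set: T] (fun x => b x * f x) by exact: measurable_funM.
have maf : measurable_fun [set: T] (fun x => a x * f x) by exact: measurable_funM.
have bf0 x : 0 <= b x * f x by rewrite mulr_ge0.
have N1 : (\int[gamma]_x (b x * f x)%:E <= 1)%E.
  apply: le_trans (_ : \int[gamma]_x (cst 1 x) <= 1)%E.
    apply: ge0_le_integral => //; last by move=> x _; rewrite lee_fin.
      by move=> x _; rewrite lee_fin.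
    exact/measurable_EFinP.
  by rewrite integral_cst// mul1e; exact: probability_le1.
have Nfin : (\int[gamma]_x (b x * f x)%:E)%E \is a fin_num.
  rewrite ge0_fin_numE; first exact: le_lt_trans N1 (ltry _).
  by apply: integral_ge0 => x _; rewrite lee_fin.
have key : (entropy gamma f + (1 + \int[gamma]_x (b x * f x)%:E) =
    \int[gamma]_x (a x * f x)%:E + 1)%E.
  have addE (u v : T -> R) : measurable_fun [set: T] u ->
      measurable_fun [set: T] v -> (forall x, 0 <= u x) -> (forall x, 0 <= v x) ->
      (\int[gamma]_x (u x)%:E + \int[gamma]_x (v x)%:E =
       \int[gamma]_x (u x + v x)%:E)%E.
    move=> mu_ mv u0 v0; rewrite -ge0_integralD//;
      by [apply/measurable_EFinP|move=> x _; rewrite lee_fin].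
  have af0 x : 0 <= a x * f x by rewrite mulr_ge0.
  have psif0 x : 0 <= psi (f x) by exact: psi_ge0.
  have g1 : (\int[gamma]_x (cst 1 x)%:E = 1)%E.
    rewrite [LHS](integral_cst gamma measurableT 1%E) mul1e.
    exact: probability_setT.
  rewrite -{1}f1 -g1 /entropy !addE//.
  - apply: eq_integral => x _; congr (_%:E); rewrite /psi.
    rewrite /a /b /=; have [lnf|lnf] := leP 0 (ln (f x)).
      by rewrite max_r ?oppr_le0//; lra.
    by rewrite max_l ?oppr_ge0 ?(ltW lnf)//; lra.
  - exact: measurable_psi_comp.
  - exact: measurable_funD.
  - by move=> x; rewrite addr_ge0.
move: key; rewrite -(fineK Nfin).
move: (entropy gamma f) (\int[gamma]_x (a x * f x)%:E)%E => [p| |] [q| |]//=.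
rewrite -!EFinD => -[pq]; congr (_%:E); lra.
Qed.

End has_density.

(** * Bounded Lipschitz test functions *)

Lemma continuous_borel_measurable (R : realType) (X : ptopologicalType)
    (g : X -> R) : continuous g -> measurable_fun [set: borel X] g.
Proof.
move=> /continuousP cg.
apply: (measurability _ (RGenOpens.measurableE R)) => _ [_ [a [b ->] <-]].
by rewrite setTI; apply: sub_sigma_algebra; apply: cg; exact: interval_open.
Qed.

Lemma bounded_borel_integrable (R : realType) (X : ptopologicalType)
    (P : probability (borel X) R) (g : X -> R) M :
  measurable_fun [set: borel X] g -> (forall x, `|g x| <= M) ->
  P.-integrable [set: borel X] (EFin \o g).
Proof.
move=> mg gM; apply: measurable_bounded_integrable => //.
  by rewrite -ge0_fin_numE// fin_num_measure.
by exists M; split; [exact: num_real|move=> x /ltW Mx y _; exact: le_trans Mx].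
Qed.

Section bounded_lipschitz.
Context {R : realType} {d : nat}.
Local Notation V := 'rV[R]_d.

(** The norm on [V] is the sup norm. It is at most the Euclidean norm, so the quadratic cost still
    controls these functions. *)
Definition bounded_lipschitz (g : V -> R) :=
  (forall x, `|g x| <= 1) /\ (forall x y, `|g x - g y| <= `|x - y|).

Lemma lipschitz1_continuous (g : V -> R) :
  (forall x y, `|g x - g y| <= `|x - y|) -> continuous g.
Proof.
move=> gl x; apply/(@cvgrPdist_lt _ _ _ (nbhs x)) => e e0.
apply: filterS (nbhsx_ballx x e e0) => y; rewrite -ball_normE /=.
exact: le_lt_trans.
Qed.

Lemma bounded_lipschitz_measurable (g : V -> R) : bounded_lipschitz g ->
  measurable_fun [set: borel V] g.
Proof.
move=> [_ gl]; apply: continuous_borel_measurable.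
exact: lipschitz1_continuous.
Qed.

Definition setdist (F : set V) (x : V) := inf [set `|x - y| | y in F].

Lemma setdist_lb (F : set V) x : has_lbound [set `|x - y| | y in F].
Proof. by exists 0 => _ [y _ <-]. Qed.

Lemma setdist_ge0 (F : set V) x : F !=set0 -> 0 <= setdist F x.
Proof. by move=> [y Fy]; apply: lb_le_inf; [exists `|x - y|, y|move=> _ [z _ <-]]. Qed.

Lemma setdist_lipschitz (F : set V) x y : F !=set0 ->
  `|setdist F x - setdist F y| <= `|x - y|.
Proof.
move=> [z0 Fz0].
have H u v : setdist F u - `|u - v| <= setdist F v.
  apply: lb_le_inf; first by exists `|v - z0|, z0.
  move=> _ [z Fz <-]; rewrite lerBlDl.
  apply: (@le_trans _ _ `|u - z|); first by apply: ge_inf; [exact: setdist_lb|exists z].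
  exact: ler_distD.
by rewrite ler_norml; have := H x y; have := H y x; rewrite (distrC y x); lra.
Qed.

Lemma setdist0 (F : set V) x : F x -> setdist F x = 0.
Proof.
move=> Fx; apply/eqP; rewrite eq_le setdist_ge0 ?andbT; last by exists x.
by apply: ge_inf; [exact: setdist_lb|exists x => //; rewrite subrr normr0].
Qed.

Lemma setdist_gt0 (F : set V) x : F !=set0 -> closed F -> ~ F x -> 0 < setdist F x.
Proof.
move=> F0 cF nFx; have : nbhs x (~` F).
  by apply: open_nbhs_nbhs; split => //; exact: closed_openC.
move=> /nbhs_ballP[e /= e0 xe]; apply: lt_le_trans e0 _.
apply: lb_le_inf; first by case: F0 => y Fy; exists `|x - y|, y.
move=> _ [y Fy <-]; rewrite leNgt; apply/negP => xy.
by apply: (xe y) Fy; rewrite -ball_normE.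
Qed.

(** Open sets are stable under intersection and generate the Borel sets, so agreement on them
    suffices. The indicator of an open set is the increasing limit of truncated multiples of the
    distance to its complement. *)
Lemma bounded_lipschitz_measure_eq (P Q : probability (borel V) R) :
  (forall g, bounded_lipschitz g ->
    \int[P]_x g x = \int[Q]_x g x) -> P ≡μ Q.
Proof.
move=> PQ.
suff PQopen U : open U -> P U = Q U.
  move=> A mA.
  apply: (@g_sigma_algebra_measure_unique _ _ (borel V) (@open V) _
    (fun=> setT)) => //.
  - by move=> U oU; exact: sub_sigma_algebra.
  - by move=> _; exact: openT.
  - by rewrite bigcup_const//; exists 0%N.
  - by move=> U W; exact: openI.
  - by move=> _; rewrite -ge0_fin_numE// fin_num_measure.
(* The distance to the complement is meaningful only if the complement is nonempty; otherwise [U] is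
   the whole space. *)
move=> oU; have [F0|/set0P F0] := eqVneq (~` U) set0.
  have -> : U = setT by rewrite -[U]setCK F0 setC0.
  by transitivity (1%E : \bar R); [exact: probability_setT|exact/esym/probability_setT].
pose D := setdist (~` U).
have cF : closed (~` U) by exact: open_closedC.
(* Truncating before scaling keeps [g n] 1-Lipschitz and bounded by 1; the multiple [phi n] is
   [min (1, (n + 1) D)]. *)
pose g n x := Num.min n.+1%:R^-1 (D x).
have gbl n : bounded_lipschitz (g n).
  have n1 : n.+1%:R^-1 <= 1 :> R by rewrite invf_le1// ler1n.
  split=> [x|x y].
    rewrite ger0_norm; first by rewrite ge_min n1.
    by rewrite le_min invr_ge0 ler0n setdist_ge0.
  have := setdist_lipschitz x y F0; rewrite -/(D x) -/(D y) !ler_norml.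
  rewrite /g; move: (D x) (D y) `|x - y| n.+1%:R^-1 => Dx Dy r a.
  by case: (leP a Dx); case: (leP a Dy); lra.
have g0 n x : 0 <= g n x by rewrite le_min invr_ge0 ler0n setdist_ge0.
pose phi n x := (n.+1%:R * g n x)%:E.
have mphi n : measurable_fun [set: borel V] (phi n).
  apply/measurable_EFinP; apply: measurable_funM => //.
  exact: bounded_lipschitz_measurable.
have PU (M : probability (borel V) R) :
    M U = limn (fun n => \int[M]_x phi n x)%E.
  rewrite -(monotone_convergence M measurableT)//.
  - rewrite -[U in LHS]setIT -integral_indic//; last exact: sub_sigma_algebra.
    apply: eq_integral => x _; apply/esym/cvg_lim => //.
    have [Ux|nUx] := pselect (U x).
      rewrite indicE mem_set//.
      have D0 : 0 < D x by apply: setdist_gt0 => //; exact: contra_not.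
      apply: cvg_near_cst; have [N _ NP] := near_infty_natSinv_lt (PosNum D0).
      exists N => // n /= Nn; rewrite /phi /g min_l ?divff//.
      exact/ltW/NP.
    rewrite indicE memNset//; apply: cvg_near_cst; apply: nearW => n.
    by rewrite /phi /g /D setdist0// min_r ?mulr0 ?invr_ge0.
  - by move=> n x _; rewrite lee_fin mulr_ge0.
  - move=> x _ n m nm; rewrite lee_fin /g !minr_pMr// !divff//.
    rewrite le_min ge_min lexx/= ge_min; apply/orP; right.
    by rewrite ler_wpM2r ?setdist_ge0// ler_nat.
rewrite !PU; congr (limn _); apply/funext => n.
have phiE (M : probability (borel V) R) :
    (\int[M]_x phi n x = (n.+1%:R * \int[M]_x g n x)%:E)%E.
  have gi : M.-integrable [set: borel V] (EFin \o g n).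
    exact: bounded_borel_integrable (bounded_lipschitz_measurable (gbl n)) (gbl n).1.
  rewrite EFinM -EFin_Rintegral// -ge0_integralZl//.
  - by apply/measurable_EFinP; exact: bounded_lipschitz_measurable.
  - by move=> x _; rewrite lee_fin.
by rewrite !phiE PQ.
Qed.

(** Every coordinate is bounded by the Euclidean norm; the factor 2 undoes the one half in the
    cost. *)
Lemma rV_norm_sqr_le (x y : V) : `|x - y| ^+ 2 <= 2 * quadratic_cost x y.
Proof.
have s0 : 0 <= \sum_(i < d) (x ord0 i - y ord0 i) ^+ 2.
  by apply: sumr_ge0 => i _; exact: sqr_ge0.
rewrite /quadratic_cost mulrA divff// mul1r.
rewrite -[leRHS]sqr_sqrtr// lerXn2r ?nnegrE ?sqrtr_ge0//.
rewrite [leLHS]/Num.norm/= mx_normrE; apply/bigmax_leP; split; first exact: sqrtr_ge0.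
move=> [i j] _ /=; rewrite -sqrtr_sqr ler_wsqrtr// !mxE (ord1 i).
by rewrite (bigD1 j)//= lerDl sumr_ge0// => k _; exact: sqr_ge0.
Qed.

End bounded_lipschitz.

(** * Transport cost *)

Section diagonal.
Context {X : ptopologicalType}.

(** The image of a measure under the diagonal map is a coupling of that measure with itself, of zero
    transport cost. *)
Definition bdiag : borel X -> borel (X * X)%type := fun x => (x, x).

Lemma measurable_bdiag : measurable_fun [set: borel X] bdiag.
Proof.
apply: (@measurability _ _ (borel X) (borel (X * X)%type) _ _
  (@open (X * X)%type)) => //.
move=> _ [A oA <-]; rewrite setTI; apply: sub_sigma_algebra.
apply: (@open_comp _ _ (fun x : X => (x, x)) A _ oA) => z _.
exact: (cvg_pair (@cvg_id _ (nbhs z)) (@cvg_id _ (nbhs z))).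
Qed.

HB.instance Definition _ := isMeasurableFun.Build _ _ _ _ bdiag measurable_bdiag.

End diagonal.

Section optimal_transport.
Context {R : realType} {d : nat}.
Local Notation V := 'rV[R]_d.
Implicit Types (mu nu rho : probability (borel V) R)
  (P : probability (borel (V * V)%type) R).

Lemma quadratic_cost_ge0 (x y : V) : 0 <= quadratic_cost x y.
Proof. by rewrite mulr_ge0// sumr_ge0// => i _; exact: sqr_ge0. Qed.

Lemma measurable_quadratic_cost : measurable_fun [set: borel (V * V)%type]
  (fun z => quadratic_cost (bfst z) (bsnd z)).
Proof.
have mcoord (i : 'I_d) : measurable_fun [set: borel V] (fun x : V => x ord0 i).
  by apply: continuous_borel_measurable => x; exact: coord_continuous.
apply: measurable_funM => //; apply: measurable_sum => i.
apply: measurable_funX; apply: measurable_funB.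
  exact: (measurableT_comp (mcoord i) (@measurable_bfst V V)).
exact: (measurableT_comp (mcoord i) (@measurable_bsnd V V)).
Qed.

Lemma OT_ge0 mu nu : (0 <= OT mu nu)%E.
Proof.
apply: le_ereal_inf_tmp => _ [kappa _ <-]; apply: integral_ge0 => z _.
by rewrite lee_fin quadratic_cost_ge0.
Qed.

Lemma OT_eq0 mu nu : nu ≡μ mu -> OT mu nu = 0%E.
Proof.
move=> numu; apply/eqP; rewrite eq_le OT_ge0 andbT.
apply: ereal_inf_lbound; exists (distribution mu bdiag).
  split=> A mA; first by [].
  by rewrite numu.
rewrite ge0_integral_distribution//.
- apply: integral0_eq => x _; rewrite /= /bfst /bsnd /= /quadratic_cost.
  by rewrite big1 ?mulr0// => i _; rewrite subrr expr0n.
- by apply/measurable_EFinP; exact: measurable_quadratic_cost.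
- by move=> z; rewrite lee_fin quadratic_cost_ge0.
Qed.

Lemma Rintegral_marginal1 P mu (g : V -> R) : marginal1 P ≡μ mu ->
  bounded_lipschitz g -> \int[mu]_x g x = \int[P]_z g (bfst z).
Proof.
move=> Pmu gbl; have mg := bounded_lipschitz_measurable gbl.
rewrite /Rintegral; congr fine.
rewrite -(@eq_measure_integral _ _ _ _ mu (marginal1 P)); last first.
  by move=> A mA _; exact: Pmu.
apply: integral_distribution; first exact/measurable_EFinP.
apply: (@bounded_borel_integrable _ _ _ (g \o bfst) 1); last by move=> z; exact: gbl.1.
exact: (measurableT_comp mg (@measurable_bfst V V)).
Qed.

Lemma Rintegral_marginal2 P nu (g : V -> R) : marginal2 P ≡μ nu ->
  bounded_lipschitz g -> \int[nu]_x g x = \int[P]_z g (bsnd z).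
Proof.
move=> Pnu gbl; have mg := bounded_lipschitz_measurable gbl.
rewrite /Rintegral; congr fine.
rewrite -(@eq_measure_integral _ _ _ _ nu (marginal2 P)); last first.
  by move=> A mA _; exact: Pnu.
apply: integral_distribution; first exact/measurable_EFinP.
apply: (@bounded_borel_integrable _ _ _ (g \o bsnd) 1); last by move=> z; exact: gbl.1.
exact: (measurableT_comp mg (@measurable_bsnd V V)).
Qed.

(* [|x - y| <= t + |x - y|^2 / t] bounds a Lipschitz difference by the cost. *)
Lemma OT_bounded_lipschitz mu nu (c t : R) (g : V -> R) :
  (OT mu nu < c%:E)%E -> 0 < t -> bounded_lipschitz g ->
  `|(\int[mu]_x g x) - (\int[nu]_x g x)| <= t + 2 / t * c.
Proof.
(* The strict bound provides a coupling of cost below [c], whether or not the infimum is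
   attained. *)
move=> /ereal_inf_lt[_ [kappa [kmu knu] <-] kc] t0 gbl.
have mg := bounded_lipschitz_measurable gbl.
rewrite (Rintegral_marginal1 kmu gbl) (Rintegral_marginal2 knu gbl).
have i1 : kappa.-integrable [set: borel (V * V)%type] (EFin \o (fun z => g (bfst z))).
  apply: (@bounded_borel_integrable _ _ _ (g \o bfst) 1); last by move=> z; exact: gbl.1.
  exact: (measurableT_comp mg (@measurable_bfst V V)).
have i2 : kappa.-integrable [set: borel (V * V)%type] (EFin \o (fun z => g (bsnd z))).
  apply: (@bounded_borel_integrable _ _ _ (g \o bsnd) 1); last by move=> z; exact: gbl.1.
  exact: (measurableT_comp mg (@measurable_bsnd V V)).
have ic : kappa.-integrable [set: borel (V * V)%type]
    (EFin \o (fun z => quadratic_cost (bfst z) (bsnd z))).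
  apply: integrable_ge0; first exact: measurable_quadratic_cost.
    by move=> z; exact: quadratic_cost_ge0.
  exact: lt_trans kc (ltry _).
have kcR : \int[kappa]_z quadratic_cost (bfst z) (bsnd z) <= c.
  by rewrite -lee_fin -EFin_Rintegral// ltW.
have it : kappa.-integrable [set: borel (V * V)%type] (EFin \o cst t).
  exact: finite_measure_integrable_cst.
have i2c : kappa.-integrable [set: borel (V * V)%type]
    (EFin \o (fun z => 2 / t * quadratic_cost (bfst z) (bsnd z))).
  exact: (integrableZl measurableT (2 / t) ic).
have id : kappa.-integrable [set: borel (V * V)%type]
    (EFin \o (fun z => g (bfst z) - g (bsnd z))).
  exact: (integrableB measurableT i1 i2).
rewrite -RintegralB//; apply: le_trans (le_normr_Rintegral measurableT id) _.
apply: (@le_trans _ _ (\int[kappa]_z (cst t z + 2 / t * quadratic_cost (bfst z) (bsnd z)))).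
  apply: le_Rintegral => //.
  - exact: integrable_dist.
  - exact: (integrableD measurableT it i2c).
  move=> z _; apply: le_trans (gbl.2 _ _) _.
  have := rV_norm_sqr_le (bfst z) (bsnd z).
  move: `|_ - _| (quadratic_cost _ _) => r q rq /=.
  rewrite -(ler_pM2l t0).
  have -> : t * (t + 2 / t * q) = t ^+ 2 + 2 * q by field; rewrite gt_eqF.
  by have := sqr_ge0 (2 * r - t); have := sqr_ge0 t; rewrite !expr2 in rq *; lra.
rewrite (RintegralD measurableT it i2c) (RintegralZl (2 / t) measurableT ic).
rewrite Rintegral_cst//.
have -> : fine (kappa [set: borel (V * V)%type]) = 1.
  by have /(congr1 fine) := probability_setT kappa.
by rewrite mulr1 lerD2l ler_wpM2l// divr_ge0// ltW.
Qed.

End optimal_transport.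

(** * Couplings as moment constraints *)

Section has_density_dist.
Context d (T : measurableType d) (R : realType) (gamma : probability T R).
Implicit Types P Q : probability T R.

Lemma has_density_integral_dist P Q f g (h : T -> R) M e :
  has_density gamma P f -> has_density gamma Q g ->
  measurable_fun [set: T] h -> (forall x, `|h x| <= M) -> 0 <= M ->
  (\int[gamma]_x `|f x - g x|%:E <= e%:E)%E ->
  `|(\int[P]_x h x) - (\int[Q]_x h x)| <= M * e.
Proof.
move=> Pf Qg mh hM M0 fge.
have fi := pdf_integrable (has_density_pdf Pf).
have gi := pdf_integrable (has_density_pdf Qg).
rewrite /Rintegral (integral_bounded_has_density Pf mh hM).
rewrite (integral_bounded_has_density Qg mh hM) /=.
apply: le_trans (dist_bounded_moment mh hM fi gi) _.
rewrite ler_wpM2l// -lee_fin -EFin_Rintegral//; exact: integrable_dist.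
Qed.

(** Tested on indicators, the two measures differ by at most the L1 distance of their densities. *)
Lemma has_density_measure_eq P Q f g :
  has_density gamma P f -> has_density gamma Q g ->
  (forall e : R, 0 < e -> (\int[gamma]_x `|f x - g x|%:E <= e%:E)%E) ->
  P ≡μ Q.
Proof.
move=> Pf Qg fg A mA.
have mI : measurable_fun [set: T] (\1_A : T -> R) by exact: measurable_indic.
have I1 x : `|(\1_A x : R)| <= 1.
  by rewrite indicE; case: (x \in A); rewrite ?normr1 ?normr0.
have IE (M : probability T R) : M A = (\int[M]_x (\1_A x : R))%:E.
  rewrite -EFin_Rintegral; last exact: integrable_indic.
  by rewrite integral_indic// setIT.
rewrite [LHS](IE P) [RHS](IE Q); congr (_%:E); apply/eqP; rewrite -subr_eq0 -normr_le0.
apply/ler_addgt0Pr => e e0; rewrite add0r -[leRHS]mul1r.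
by apply: (has_density_integral_dist Pf Qg) => //; exact: fg.
Qed.

Lemma relative_entropy_ge0 P : (0 <= relative_entropy P gamma)%E.
Proof.
have [PG|PG] := pselect (P `<< gamma)%E; last by rewrite /relative_entropy asboolF.
have [f Pf] := dominated_has_density PG.
by rewrite (relative_entropy_has_density Pf) entropy_ge0//; exact: has_density_pdf Pf.
Qed.

Lemma relative_entropy_lty_density P : (relative_entropy P gamma < +oo)%E ->
  exists f, has_density gamma P f.
Proof.
rewrite /relative_entropy; case: asboolP => [PG _|]; last by rewrite ltxx.
exact: dominated_has_density.
Qed.

End has_density_dist.

Section coupling_moments.
Context {R : realType} {d : nat}.
Local Notation V := 'rV[R]_d.
Variables (mu nu : probability (borel V) R)
  (gamma : probability (borel (V * V)%type) R).
Implicit Types P : probability (borel (V * V)%type) R.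

(** Bounded Lipschitz tests meet two demands: they determine a measure, so tolerance 0 means being a
    coupling, and the transport cost controls their integrals, so a small cost means a small
    tolerance. *)
Definition marginal_tests : set ((borel (V * V)%type -> R) * R) :=
  [set p | exists2 g, bounded_lipschitz g &
    p = (g \o bfst, \int[mu]_x g x) \/ p = (g \o bsnd, \int[nu]_x g x)].

Lemma marginal_tests_bounded p : marginal_tests p ->
  measurable_fun [set: borel (V * V)%type] p.1 /\ forall z, `|p.1 z| <= 1.
Proof.
move=> [g gbl pE]; have mg := bounded_lipschitz_measurable gbl.
case: pE => -> /=; split=> [|z]; try exact: gbl.1.
  exact: (measurableT_comp mg (@measurable_bfst V V)).
exact: (measurableT_comp mg (@measurable_bsnd V V)).
Qed.

Lemma marginal_tests_integral P f p : has_density gamma P f ->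
  marginal_tests p -> \int[P]_z p.1 z = \int[gamma]_z (p.1 z * f z).
Proof.
move=> Pf /marginal_tests_bounded[mp p1].
by rewrite {1}/Rintegral (integral_bounded_has_density Pf mp p1).
Qed.

Lemma couplings_moment_set P f : has_density gamma P f ->
  couplings mu nu P -> moment_set gamma marginal_tests 0 f.
Proof.
move=> Pf [Pmu Pnu]; split; first exact: has_density_pdf Pf.
move=> p Sp; rewrite -(marginal_tests_integral Pf Sp).
have [g gbl [->|->]] := Sp => /=.
  by rewrite (Rintegral_marginal1 Pmu gbl) subrr normr0.
by rewrite (Rintegral_marginal2 Pnu gbl) subrr normr0.
Qed.

Lemma moment_set_couplings P f : has_density gamma P f ->
  moment_set gamma marginal_tests 0 f -> couplings mu nu P.
Proof.
move=> Pf [_ fS]; split; apply: bounded_lipschitz_measure_eq => g gbl.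
  (* Taking the marginal of [P] itself as the target pulls its integrals back to the product
     space. *)
  rewrite (@Rintegral_marginal1 _ _ P (marginal1 P))//.
  have Sp : marginal_tests (g \o bfst, \int[mu]_x g x) by exists g => //; left.
  have := fS _ Sp; rewrite -(marginal_tests_integral Pf Sp) normr_le0 subr_eq0.
  by move/eqP.
rewrite (@Rintegral_marginal2 _ _ P (marginal2 P))//.
have Sp : marginal_tests (g \o bsnd, \int[nu]_x g x) by exists g => //; right.
have := fS _ Sp; rewrite -(marginal_tests_integral Pf Sp) normr_le0 subr_eq0.
by move/eqP.
Qed.

Lemma OT_moment_set P f (c t : R) : has_density gamma P f -> 0 < t ->
  (OT mu (marginal1 P) < c%:E)%E -> (OT nu (marginal2 P) < c%:E)%E ->
  moment_set gamma marginal_tests (t + 2 / t * c) f.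
Proof.
move=> Pf t0 c1 c2; split; first exact: has_density_pdf Pf.
move=> p Sp; rewrite -(marginal_tests_integral Pf Sp).
have [g gbl [->|->]] := Sp => /=.
  rewrite -(@Rintegral_marginal1 _ _ P (marginal1 P))// distrC.
  exact: OT_bounded_lipschitz.
rewrite -(@Rintegral_marginal2 _ _ P (marginal2 P))// distrC.
exact: OT_bounded_lipschitz.
Qed.

(** The three terms of the objective are nonnegative, so each is at most [J]; the transport terms
    are then multiplied by [eps]. *)
Lemma relaxed_objective_bounds (eps J : R) P : 0 < eps ->
  (relaxed_objective mu nu gamma eps P <= J%:E)%E ->
  [/\ (OT mu (marginal1 P) <= (eps * J)%:E)%E,
      (OT nu (marginal2 P) <= (eps * J)%:E)%E &
      (relative_entropy P gamma <= J%:E)%E].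
Proof.
move=> e0; rewrite /relaxed_objective.
have := OT_ge0 mu (marginal1 P); have := OT_ge0 nu (marginal2 P).
have := relative_entropy_ge0 gamma P.
move: (OT mu _) (OT nu _) (relative_entropy _ _) => a b c c0 b0 a0.
have ve0 : 0 <= eps^-1 by rewrite invr_ge0 ltW.
have ea0 : (0 <= eps^-1%:E * a)%E by rewrite mule_ge0.
have eb0 : (0 <= eps^-1%:E * b)%E by rewrite mule_ge0.
move=> abc; split; last first.
- by apply: le_trans abc; rewrite leeDr// adde_ge0.
- have : (eps^-1%:E * b <= J%:E)%E.
    by apply: le_trans abc; rewrite addeAC leeDr// adde_ge0.
  rewrite EFinM -lee_pdivrMl// lte_fin.
- have : (eps^-1%:E * a <= J%:E)%E.
    by apply: le_trans abc; rewrite -addeA leeDl// adde_ge0.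
  rewrite EFinM -lee_pdivrMl// lte_fin.
Qed.

End coupling_moments.

(** * Convergence of the relaxed optimizers *)

Theorem proposition4p1 (R : realType) (d : nat)
    (mu nu : probability (borel 'rV[R]_d) R)
    (gamma : probability (borel ('rV[R]_d * 'rV[R]_d)%type) R)
    (hfeas : exists pi, couplings mu nu pi /\
      (relative_entropy pi gamma < +oo)%E) :
  exists pi0 : probability (borel ('rV[R]_d * 'rV[R]_d)%type) R,
    is_unique_minimizer (couplings mu nu)
      (fun pi => relative_entropy pi gamma) pi0 /\
    forall pi_ : R -> probability (borel ('rV[R]_d * 'rV[R]_d)%type) R,
      (forall eps : R, 0 < eps ->
        is_minimizer setT (relaxed_objective mu nu gamma eps) (pi_ eps)) ->
      weak_cvg 0^'+ pi_ pi0.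
Proof.
case: hfeas => pis [pisC pisy].
have [fs pisfs] := relative_entropy_lty_density pisy.
have fsK := couplings_moment_set pisfs pisC.
have fsy : (entropy gamma fs < +oo)%E by rewrite -(relative_entropy_has_density pisfs).
have [f0 [f0K f0y f0min f0stab]] :=
  entropy_projection (@marginal_tests_bounded R d mu nu) fsK fsy.
have := density_probabilityP f0K.1.
move: (density_probability f0K.1) => pi0 pi0f0.
have pi0C := moment_set_couplings pi0f0 f0K.
have pi0E := relative_entropy_has_density pi0f0.
exists pi0; split.
  split.
    split => // P PC; rewrite pi0E.
    have [->|] := eqVneq (relative_entropy P gamma) +oo%E; first exact: leey.
    rewrite -ltey => Py; have [f Pf] := relative_entropy_lty_density Py.
    rewrite (relative_entropy_has_density Pf); apply: f0min.
    exact: couplings_moment_set Pf PC.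
  (* Uniqueness is the stability clause again: another minimizer is admissible at every tolerance
     with entropy at most that of [f0], so its density is within every [e] of [f0] in L1. *)
  move=> P [PC Pmin]; have := Pmin _ pi0C; rewrite pi0E => Pf0.
  have [f Pf] := relative_entropy_lty_density (le_lt_trans Pf0 f0y).
  rewrite (relative_entropy_has_density Pf) in Pf0.
  apply: (has_density_measure_eq Pf pi0f0) => e /f0stab[delta delta0]; apply => //.
  exact: moment_setS (ltW delta0) _ (couplings_moment_set Pf PC).
move=> pi_ pi_min h ch [M [_ hM]].
(* Boundedness is given for every constant strictly above [M]; this one is also positive, as the
   division by [K] requires. *)
pose K := `|M| + 1; have K0 : 0 < K by rewrite ltr_wpDl.
have hK z : `|h z| <= K by apply: hM => //; rewrite ltr_pwDr// ler_norm.
have mh : measurable_fun [set: borel ('rV[R]_d * 'rV[R]_d)%type] h.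
  exact: continuous_borel_measurable.
have hE (P : probability (borel ('rV[R]_d * 'rV[R]_d)%type) R) :
    (\int[P]_z (h z)%:E = (\int[P]_z h z)%:E)%E.
  by rewrite EFin_Rintegral//; exact: bounded_borel_integrable hK.
rewrite hE; under eq_fun do rewrite hE.
apply: cvg_EFin; first exact: nearW.
apply/cvgrPdist_le => e e0.
have [delta delta0 f0delta] := f0stab _ (divr_gt0 e0 K0).
pose J := fine (entropy gamma f0).
have JE : entropy gamma f0 = J%:E.
  by rewrite fineK// ge0_fin_numE// entropy_ge0//; exact: f0K.1.
have J0 : 0 <= J by rewrite -lee_fin -JE entropy_ge0//; exact: f0K.1.
(* Both terms of the tolerance [t + 2 / t * c] are then [delta / 2]. *)
pose t := delta / 2; pose c := delta ^+ 2 / 8.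
have t0 : 0 < t by rewrite divr_gt0.
have c0 : 0 < c by rewrite divr_gt0// exprn_gt0.
have tc : t + 2 / t * c = delta by rewrite /t /c; field; rewrite gt_eqF.
(* The minimal entropy [J] may be 0, so the threshold for [eps] is [c / (J + 1)]. *)
have J1 : 0 < J + 1 by rewrite ltr_wpDl.
near=> eps.
have eps0 : 0 < eps by near: eps; exact: nbhs_right_gt.
have epsc : eps * J < c.
  apply: (@le_lt_trans _ _ (eps * (J + 1))).
    by rewrite ler_wpM2l ?(ltW eps0)// lerDl.
  rewrite -ltr_pdivlMr//; near: eps; apply: nbhs_right_lt.
  by rewrite divr_gt0.
(* The competitor [pi0] has marginals [mu] and [nu]: its transport terms vanish and its objective is
   [J] for every [eps]. *)
have objJ : (relaxed_objective mu nu gamma eps (pi_ eps) <= J%:E)%E.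
  apply: le_trans ((pi_min _ eps0).2 pi0 I) _; rewrite /relaxed_objective.
  by rewrite !OT_eq0 ?mule0 ?add0e ?pi0E ?JE//; [exact: pi0C.2|exact: pi0C.1].
have [OT1 OT2 Jeps] := relaxed_objective_bounds eps0 objJ.
have [f Pf] := relative_entropy_lty_density (le_lt_trans Jeps (ltry _)).
have epscE : ((eps * J)%:E < c%:E)%E by rewrite lte_fin.
have fK := OT_moment_set Pf t0 (le_lt_trans OT1 epscE) (le_lt_trans OT2 epscE).
rewrite tc in fK.
(* The optimizer meets the constraints up to [delta] with entropy at most the minimal one, which are
   the two premises of the stability clause. *)
have ff0 : (entropy gamma f <= entropy gamma f0)%E.
  by rewrite JE -(relative_entropy_has_density Pf).
rewrite distrC.
apply: le_trans (has_density_integral_dist Pf pi0f0 mh hK (ltW K0) (f0delta _ fK ff0)) _.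
by rewrite mulrCA divff ?mulr1// gt_eqF.
Unshelve. all: end_near.
Qed.
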